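(* Let $\varepsilon,\delta\in(0,1)$, let $P_{s1}>P_{s2}\ge0$, and denote $\Delta P_s=P_{s1}-P_{s2}$. In the two-power noisy Rayleigh measurement model described in the context, if $$N>\frac{2(3+2\varepsilon)\ln\frac4\delta}{3\varepsilon^2},$$ then with probability greater than $1-\delta$ the following two chains of inequalities hold simultaneously: $$\frac{1}{\Delta P_s}\left(\frac{\overline{X_{1,N}^2}}{1+\varepsilon}-\frac{\overline{X_{2,N}^2}}{1-\varepsilon}\right)<\sigma_H^2<\frac{1}{\Delta P_s}\left(\frac{\overline{X_{1,N}^2}}{1-\varepsilon}-\frac{\overline{X_{2,N}^2}}{1+\varepsilon}\right)$$ and $$\frac{1}{\Delta P_s}\left(\frac{P_{s1}\overline{X_{2,N}^2}}{1+\varepsilon}-\frac{P_{s2}\overline{X_{1,N}^2}}{1-\varepsilon}\right)<\sigma_V^2<\frac{1}{\Delta P_s}\left(\frac{P_{s1}\overline{X_{2,N}^2}}{1-\varepsilon}-\frac{P_{s2}\overline{X_{1,N}^2}}{1+\varepsilon}\right).$$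
   Context: Two-power noisy Rayleigh measurement model: let $\sigma_H^2,\sigma_V^2>0$. For $\ell=1,2$ and $i=1,\dots,N$ ($N$ a positive integer), real (BPSK) symbols $S_{\ell,i}$ with $|S_{\ell,i}|^2=P_{s\ell}$ are transmitted, and one observes the complex random variables $X_{\ell,i}=H_{\ell,i}S_{\ell,i}+V_{\ell,i}$, where the real and imaginary parts of $H_{\ell,i}$ are Gaussian with mean $0$ and variance $\sigma_H^2$, the real and imaginary parts of $V_{\ell,i}$ are Gaussian with mean $0$ and variance $\sigma_V^2$, and all these real and imaginary parts (over all $\ell,i$) are mutually independent. Thus the $X_{\ell,i}$ are mutually independent, and the real and imaginary parts of $X_{\ell,i}$ are independent centered Gaussians of variance $P_{s\ell}\sigma_H^2+\sigma_V^2$. Define $$\overline{X_{\ell,N}^2}=\frac{1}{2N}\sum_{i=1}^{N}|X_{\ell,i}|^2,\qquad \ell=1,2.$$ *)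

(* Defs.v *)
From mathcomp Require Import all_boot all_order all_algebra.
From mathcomp Require Import complex.
From mathcomp Require Import all_classical all_reals all_analysis.

Set Implicit Arguments.
Unset Strict Implicit.
Unset Printing Implicit Defensive.

Import Order.TTheory GRing.Theory Num.Theory.

Local Open Scope classical_set_scope.
Local Open Scope ring_scope.

Definition mutually_independent (d d' : measure_display)
    (T : measurableType d) (T' : measurableType d') (R : realType)
    (P : probability T R) (I : finType) (Y : I -> {RV P >-> T'}) : Prop :=
  forall (J : {set I}) (A : I -> set T'), (forall i, measurable (A i)) ->
    P (\bigcap_(i in [set` J]) (Y i @^-1` A i)) =
    (\prod_(i in J) P (Y i @^-1` A i))%E.

(* The two power levels (1 and 2) are indexed by 'I_2, which starts at 0. *)
Definition l1 : 'I_2 := ord0.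
Definition l2 : 'I_2 := ord_max.

Definition rayleigh_obs (T : Type) (R : realType) (N : nat)
    (HRe HIm VRe VIm : 'I_2 -> 'I_N -> T -> R) (S : 'I_2 -> 'I_N -> R)
    (l : 'I_2) (i : 'I_N) (w : T) : R[i] :=
  (HRe l i w +i* HIm l i w)%C * (S l i)%:C%C + (VRe l i w +i* VIm l i w)%C.

(* Normalised by the 2N real components of the N complex observations, so that
   this estimates the variance of one real component. *)
Definition mean_power (T : Type) (R : realType) (N : nat)
    (X : 'I_2 -> 'I_N -> T -> R[i]) (l : 'I_2) (w : T) : R :=
  (2 * N%:R)^-1 * \sum_(i < N) ComplexField.Normc.normc (X l i w) ^+ 2.

(* Main.v *)
Require Import Defs.
From HB Require Import structures.
From mathcomp Require Import all_boot all_order all_algebra.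
From mathcomp Require Import ring lra.
From mathcomp Require Import all_classical all_reals all_analysis.
From mathcomp Require Import measurable_realfun.

(* Up to the factor [v = Ps l * sigmaH ^+ 2 + sigmaV ^+ 2], [2 * N * Xbar l] is
   a chi-square variable with [2 * N] degrees of freedom, whose moment
   generating function at [t / v] is [(1 - 2 * t) ^- N].  Chernoff's bound with the optimal
   [t] gives [((1 + x) * expR (- x)) ^+ N] for a relative deviation [x = eps] or
   [x = - eps], and [ln (1 + x) <= x - 3 * x ^+ 2 / (2 * (3 + 2 * x))] turns the
   lower bound on [N] into a tail smaller than [delta / 4].  A union bound over
   both signs and both powers confines [Xbar l] to the interval of relative
   width [eps] around its mean for [l = l1, l2]; the two chains of inequalities
   follow since [Ps l1 - Ps l2] times [sigmaH ^+ 2], respectively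
   [sigmaV ^+ 2], is a linear combination of the two means.

   Independence is only given on measurable rectangles; the expectation of the
   product over all components is computed by absorbing one fading-noise pair
   at a time into a running product that stays independent of the remaining
   variables. *)

Set Implicit Arguments.
Unset Strict Implicit.
Unset Printing Implicit Defensive.

Import Order.TTheory GRing.Theory Num.Theory.
Import numFieldNormedType.Exports.

Local Open Scope classical_set_scope.
Local Open Scope ring_scope.

(** * Independence beyond rectangles: laws of pairs and absorption of one variable *)

Section independence.
Context d d' (T : measurableType d) (T' : measurableType d') (R : realType).
Variables (P : probability T R) (I : finType) (Z : I -> {RV P >-> T'}).

(* [X] is independent of the [Z i] with [i] outside [D]; taking [B i = setT]
   drops [Z i] from the intersection. *)
Definition independent_outside d1 (T1 : measurableType d1) (X : T -> T1)
    (D : {set I}) : Prop :=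
  forall A (B : I -> set T'), measurable A -> (forall i, measurable (B i)) ->
    (forall i, i \in D -> B i = setT) ->
    (P (X @^-1` A `&` \bigcap_i (Z i @^-1` B i)) =
     P (X @^-1` A) * P (\bigcap_i (Z i @^-1` B i)))%E.

Definition RV_pair d1 d2 (T1 : measurableType d1) (T2 : measurableType d2)
  (X : T -> T1) (Y : T -> T2) (w : T) : T1 * T2 := (X w, Y w).

HB.instance Definition _ d1 d2 (T1 : measurableType d1)
    (T2 : measurableType d2) (X : {RV P >-> T1}) (Y : {RV P >-> T2}) :=
  isMeasurableFun.Build _ _ _ _ (RV_pair X Y)
    (measurable_fun_pair (measurable_funPT X) (measurable_funPT Y)).

Hypothesis Zindep : mutually_independent Z.

Lemma measurable_bigcap_preimage (B : I -> set T') :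
  (forall i, measurable (B i)) -> measurable (\bigcap_i (Z i @^-1` B i)).
Proof.
move=> mB; apply: fin_bigcap_measurable => // i _.
by rewrite -[X in measurable X]setTI; exact: measurable_funPT.
Qed.

Lemma mutually_independent_setT (B : I -> set T') :
  (forall i, measurable (B i)) ->
  P (\bigcap_i (Z i @^-1` B i)) = (\prod_i P (Z i @^-1` B i))%E.
Proof.
move=> mB; have := Zindep [set: I]%SET mB.
rewrite (_ : [set` [set: I]%SET] = setT); last first.
  by apply/seteqP; split => // i _ /=; rewrite inE.
by move=> ->; apply: eq_bigl => i; rewrite inE.
Qed.

Lemma independent_outside_cst d1 (T1 : measurableType d1) (x : T1) :
  independent_outside (cst x) finset.set0.
Proof.
move=> A B mA mB _.
have [Ax|nAx] := pselect (A x).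
  rewrite preimage_cst mem_set// setTI probability_setT mul1e//.
by rewrite preimage_cst memNset// set0I measure0 mul0e.
Qed.

Lemma independent_outside_comp d1 d2 (T1 : measurableType d1)
    (T2 : measurableType d2) (X : T -> T1) (f : T1 -> T2) D :
  measurable_fun setT f -> independent_outside X D ->
  independent_outside (f \o X) D.
Proof.
move=> mf iX A B mA mB BD; rewrite comp_preimage; apply: iX => //.
by rewrite -[X in measurable X]setTI; exact: mf.
Qed.

Let split_bigcap a (B : I -> set T') A' : B a = setT ->
  \bigcap_i (Z i @^-1` (if i == a then A' else B i)) =
  (Z a @^-1` A') `&` \bigcap_i (Z i @^-1` B i).
Proof.
move=> Ba; apply/seteqP; split=> w /=.
  move=> h; split; first by have := h a Logic.I; rewrite eqxx.
  by move=> i _; have := h i Logic.I; case: eqVneq => // ->; rewrite Ba.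
move=> [wA' wB] i _; case: eqVneq => [->//|_]; exact: wB.
Qed.

Lemma mutually_independent_split a (B : I -> set T') A' : measurable A' ->
  (forall i, measurable (B i)) -> B a = setT ->
  P ((Z a @^-1` A') `&` \bigcap_i (Z i @^-1` B i)) =
  (P (Z a @^-1` A') * P (\bigcap_i (Z i @^-1` B i)))%E.
Proof.
move=> mA' mB Ba; rewrite -split_bigcap//.
rewrite mutually_independent_setT; last by move=> i; case: ifP.
rewrite mutually_independent_setT// (bigD1 a)//= eqxx; congr (_ * _)%E.
rewrite [RHS](bigD1 a)//= Ba preimage_setT probability_setT mul1e.
by apply: eq_bigr => i /negbTE ->.
Qed.

Context d1 (T1 : measurableType d1) (X : {RV P >-> T1}).
Variables (D : {set I}) (a : I).
Hypotheses (aD : a \notin D) (XD : independent_outside X D).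

Local Open Scope ereal_scope.

(** Since [a] lies outside [D], the condition on [Z a] can be moved into the intersection before
    independence of [X] is used; mutual independence then splits it off again. *)
Let rectangle (B : I -> set T') A A' :
  measurable A -> measurable A' -> (forall i, measurable (B i)) ->
  (forall i, i \in (a |: D)%SET -> B i = setT) ->
  P (RV_pair X (Z a) @^-1` (A `*` A') `&` \bigcap_i (Z i @^-1` B i)) =
  P (X @^-1` A) * P (Z a @^-1` A') * P (\bigcap_i (Z i @^-1` B i)).
Proof.
move=> mA mA' mB BD.
have Ba : B a = setT by apply: BD; rewrite !inE eqxx.
have -> : RV_pair X (Z a) @^-1` (A `*` A') =
    (X @^-1` A) `&` (Z a @^-1` A') by [].
rewrite -setIA -split_bigcap// XD//.
- by rewrite split_bigcap// mutually_independent_split// muleA.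
- by move=> i; case: ifP.
- move=> i iD; case: eqVneq => [ia|_]; first by move: aD; rewrite -ia iD.
  by apply: BD; rewrite !inE iD orbT.
Qed.

(** Both measures agree on rectangles ([rectangle] with every [B i] full), and a product measure is
    determined by its values there. *)
Lemma law_RV_pair S : measurable S ->
  (distribution P X \x distribution P (Z a)) S =
  P (RV_pair X (Z a) @^-1` S).
Proof.
move=> mS.
rewrite (product_measure_unique
  (m' := distribution P (RV_pair X (Z a))))// => A A' mA mA'.
have := rectangle mA mA' (B := fun=> setT) (fun=> measurableT)
  (fun _ _ => erefl).
by rewrite (_ : \bigcap_i _ = setT) ?bigcapT// setIT probability_setT mule1.
Qed.

Lemma integral_RV_pair (f : T1 * T' -> \bar R) :
  measurable_fun setT f -> (forall z, 0 <= f z) ->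
  \int[P]_w f (X w, Z a w) =
  \int[distribution P X]_x \int[distribution P (Z a)]_y f (x, y).
Proof.
move=> mf f0; pose XZ := RV_pair X (Z a).
rewrite -[LHS](ge0_integral_distribution (XZ : {RV P >-> _}) mf)//.
rewrite -[RHS]fubini_tonelli1//.
by apply: eq_measure_integral => S mS _; exact/esym/law_RV_pair.
Qed.

(** For fixed [C] of positive probability, the law of the pair conditioned on [C] agrees with the
    product law on rectangles, hence on every measurable [S]. This gives the product formula after
    multiplying by [P C]; if [P C] is zero, both sides vanish. *)
Lemma independent_outside_pair :
  independent_outside (RV_pair X (Z a)) (a |: D)%SET.
Proof.
move=> S B mS mB BD; pose C := \bigcap_i (Z i @^-1` B i).
have mC : measurable C by exact: measurable_bigcap_preimage.
have mXZ : measurable (RV_pair X (Z a) @^-1` S).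
  by rewrite -[X in measurable X]setTI; exact: measurable_funPT.
have [PC0|PC0] := eqVneq (P C) 0.
  rewrite PC0 mule0; apply/eqP; rewrite -measure_le0 -PC0.
  by apply: le_measure; rewrite ?inE//; exact: measurableI.
have PCfin : P C \is a fin_num by exact: fin_num_measure.
have PCgt0 : (0 < fine (P C))%R.
  by rewrite fine_gt0// lt0e PC0 measure_ge0/= ltey_eq PCfin.
(* [r] normalises the restriction of [P] to [C], so that [m] is the conditional probability given
   [C]. *)
pose r : {nonneg R} := NngNum (ltW (eqbRL (@invr_gt0 _ _) PCgt0)).
pose XZ := RV_pair X (Z a).
pose m := mscale r (mrestr P mC).
have mE U : pushforward m XZ U = (fine (P C))^-1%:E * P (XZ @^-1` U `&` C).
  by [].
have : (distribution P X \x distribution P (Z a)) S = pushforward m XZ S.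
  apply: (product_measure_unique (m' := pushforward m XZ)) => // A A' mA mA'.
  rewrite [LHS]mE rectangle// muleC -muleA -[X in _ * (X * _)]fineK//.
  by rewrite -EFinM mulfV ?gt_eqF// mule1.
rewrite law_RV_pair// mE => ->.
by rewrite muleAC -[X in _ * X * _]fineK// -EFinM mulVf ?gt_eqF// mul1e.
Qed.

End independence.

(** * Expectation of a product over disjoint pairs of independent variables *)

Section expectation_prod.
Context d d' (T : measurableType d) (T' : measurableType d') (R : realType).
Variables (P : probability T R) (I : finType) (Z : I -> {RV P >-> T'}).
Hypothesis Zindep : mutually_independent Z.
Variables (Q : eqType) (a b : Q -> I) (g : Q -> T' * T' -> R).
Hypotheses (a_inj : injective a) (b_inj : injective b).
Hypothesis ab : forall q q', a q != b q'.
Hypothesis mg : forall q, measurable_fun setT (g q).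
Hypothesis g0 : forall q z, 0 <= g q z.

Local Open Scope ereal_scope.

Let step (X : {RV P >-> R}) (D : {set I}) q :
  (forall w, 0 <= X w)%R -> a q \notin D -> b q \notin D ->
  independent_outside Z X D ->
  exists X' : {RV P >-> R},
  [/\ forall w, X' w = (X w * g q (Z (a q) w, Z (b q) w))%R,
    independent_outside Z X' (b q |: (a q |: D))%SET &
    \int[P]_w (X' w)%:E = \int[P]_w (X w)%:E *
      \int[distribution P (Z (a q))]_x \int[distribution P (Z (b q))]_y
        (g q (x, y))%:E].
Proof.
move=> X0 aD bD XD.
(* The absolute value makes [f] nonnegative on the whole space, as Tonelli requires; it is harmless
   along [X], which is nonnegative. *)
pose f (z : R * T' * T') := (`|z.1.1| * g q (z.1.2, z.2))%R.
have mf : measurable_fun setT f.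
  apply: measurable_funM.
    apply: measurableT_comp => //.
    by apply: measurableT_comp => //; exact: measurable_fst.
  apply: measurableT_comp => //.
  apply: measurable_fun_pair; last exact: measurable_snd.
  by apply: measurableT_comp => //; exact: measurable_snd.
have bD' : b q \notin (a q |: D)%SET by rewrite !inE negb_or bD eq_sym ab.
have XZaD := independent_outside_pair Zindep aD XD.
have XZbD := independent_outside_pair Zindep bD' XZaD.
pose XZ := RV_pair (RV_pair X (Z (a q))) (Z (b q)).
exists (mfun_Sub (mem_set mf) \o XZ : {mfun _ >-> _}); split => /=.
- by move=> w; rewrite /f/= ger0_norm.
- exact: independent_outside_comp mf XZbD.
have mf' : measurable_fun setT (EFin \o f) by exact/measurable_EFinP.
(* [aux] is [f] with its last coordinate integrated out: first [Z (b q)] is separated from the pair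
   of [X] and [Z (a q)], then [Z (a q)] from [X]. *)
pose aux (z : R * T') := (`|z.1|%:E * \int[distribution P (Z (b q))]_y
  (g q (z.2, y))%:E).
have mgE : measurable_fun setT (EFin \o g q) by exact/measurable_EFinP.
have mG := measurable_fun_fubini_tonelli_F (m2 := distribution P (Z (b q)))
  _ mgE (fun z => ltac:(rewrite lee_fin; exact: g0)).
have maux : measurable_fun setT aux.
  apply: emeasurable_funM.
    by apply/measurable_EFinP/measurableT_comp => //; exact: measurable_fst.
  exact: (measurableT_comp mG measurable_snd).
have G0 x : 0 <= \int[distribution P (Z (b q))]_y (g q (x, y))%:E.
  by apply: integral_ge0 => y _; rewrite lee_fin.
have aux0 z : 0 <= aux z by rewrite mule_ge0// lee_fin.
have f0 z : 0 <= (EFin \o f) z by rewrite lee_fin mulr_ge0.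
rewrite [LHS](integral_RV_pair Zindep bD' XZaD mf' f0).
rewrite (eq_integral aux) => [|z _]; last first.
  rewrite /aux -ge0_integralZl_EFin//.
  - by move=> y _; rewrite lee_fin.
  - exact/measurable_EFinP/measurableT_comp.
rewrite (ge0_integral_distribution (RV_pair X (Z (a q)) : {RV P >-> _}) maux)//.
rewrite [LHS](integral_RV_pair Zindep aD XD maux aux0).
under eq_integral do rewrite /aux/= ge0_integralZl_EFin//.
rewrite ge0_integralZr//; last 2 first.
- exact: measurableT_comp.
- exact: integral_ge0.
congr (_ * _); rewrite ge0_integral_distribution//; last first.
  exact: measurableT_comp.
apply: eq_integral => w _ /=.
by rewrite ger0_norm.
Qed.

Lemma integral_prod_independent_pairs (s : seq Q) : uniq s ->
  \int[P]_w (\prod_(q <- s) g q (Z (a q) w, Z (b q) w))%:E =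
  \prod_(q <- s) \int[distribution P (Z (a q))]_x
    \int[distribution P (Z (b q))]_y (g q (x, y))%:E.
Proof.
move=> us.
(* Induction on [s] needs a running product [X] and the set [D] of indices it has used up; the
   constant 1 and the empty set start it. *)
suff gen : forall (X : {RV P >-> R}) (D : {set I}), (forall w, 0 <= X w)%R ->
    independent_outside Z X D ->
    (forall q, q \in s -> a q \notin D /\ b q \notin D) ->
    \int[P]_w (X w * \prod_(q <- s) g q (Z (a q) w, Z (b q) w))%:E =
    \int[P]_w (X w)%:E * \prod_(q <- s) \int[distribution P (Z (a q))]_x
      \int[distribution P (Z (b q))]_y (g q (x, y))%:E.
  have := gen (cst 1%R) finset.set0 (fun=> ler01) (independent_outside_cst _ _).
  under eq_integral do rewrite mul1r.
  have -> : \int[P]_w (cst 1%R w)%:E = 1.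
    transitivity (1 * P setT); first exact: (integral_cst P measurableT 1).
    by rewrite probability_setT mul1e.
  by rewrite mul1e; apply=> q _; rewrite !inE.
elim: s us => [|q s IH] us X D X0 XD sD.
  by rewrite big_nil mule1; apply: eq_integral => w _; rewrite big_nil mulr1.
case/andP: us => qs us.
have [aD bD] := sD q (mem_head _ _).
have [X' [X'E X'D intX']] := step X0 aD bD XD.
under eq_integral do rewrite big_cons mulrA -X'E.
rewrite (IH us X' _ _ X'D).
- by rewrite intX' big_cons muleA.
- by move=> w; rewrite X'E mulr_ge0.
- move=> q' q's; have [aD' bD'] := sD q' (mem_behead (s := q :: s) q's).
  have q'q : q' != q by apply: contraNneq qs => <-.
  by rewrite !inE !negb_or (inj_eq a_inj) (inj_eq b_inj) q'q aD' bD' ab eq_sym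
    ab.
Qed.

End expectation_prod.

(** * Gaussian integrals of exponentials of squares *)

Section gaussian.
Context (R : realType).
Local Notation mu := (@lebesgue_measure R).

(** Change of variables yields the Radon-Nikodym derivative, which equals [normal_pdf] almost
    everywhere because both have the same integral over every measurable set. *)
Lemma ge0_integral_normal_prob (m s : R) (f : R -> \bar R) :
  measurable_fun setT f -> (forall x, 0 <= f x)%E ->
  (\int[normal_prob m s]_x f x = \int[mu]_x (f x * (normal_pdf m s x)%:E))%E.
Proof.
move=> mf f0; have dom := normal_prob_dominates m s.
pose g := Radon_Nikodym_SigmaFinite.f (normal_prob m s) mu.
have ig : mu.-integrable setT g.
  exact: Radon_Nikodym_SigmaFinite.f_integrable.
have mpdf : measurable_fun setT (fun x => (normal_pdf m s x)%:E).
  by apply/measurable_EFinP; exact: measurable_normal_pdf.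
rewrite -(Radon_Nikodym_SigmaFinite.change_of_variables dom)//.
apply: ae_eq_integral => //.
- by apply: emeasurable_funM => //; exact: (measurable_int mu).
- exact: emeasurable_funM.
apply: ae_eqe_mul2l; apply: integral_ae_eq => //.
by move=> E _ mE; rewrite -(Radon_Nikodym_SigmaFinite.f_integral dom).
Qed.

(* [normal_prob] lives on [measurableTypeR R], which is not the default
   measurable structure on [R] although it has the same measurable sets. *)
Lemma ge0_integral_normal_law (P : {measure set R -> \bar R}) (m s : R)
    (f : R -> \bar R) : P = normal_prob m s :> (set R -> \bar R) ->
  measurable_fun setT f -> (forall x, 0 <= f x)%E ->
  (\int[P]_x f x = \int[mu]_x (f x * (normal_pdf m s x)%:E))%E.
Proof.
move=> PE mf f0; rewrite -ge0_integral_normal_prob//.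
have mid : measurable_fun setT (id : R -> measurableTypeR R).
  by move=> _ A mA; rewrite setTI.
rewrite -(@ge0_integral_pushforward _ _ _ _ _ _ mid P setT f)//.
by apply: eq_measure_integral => A _ _; exact: (congr1 (@^~ A) PE).
Qed.

(** Completing the square turns the integrand times the density into a constant times the Gaussian
    density of mean [m'] and variance [s ^+ 2 / D], which integrates to 1. *)
Lemma integral_normal_law_expR_sqr (P : {measure set R -> \bar R})
    (s c t : R) : P = normal_prob 0 s :> (set R -> \bar R) -> s != 0 ->
  2 * t * s ^+ 2 < 1 ->
  (\int[P]_x (expR (t * (c + x) ^+ 2))%:E =
   ((Num.sqrt (1 - 2 * t * s ^+ 2))^-1 *
    expR (t / (1 - 2 * t * s ^+ 2) * c ^+ 2))%:E)%E.
Proof.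
move=> PE s0 ts; set D := 1 - 2 * t * s ^+ 2.
have D0 : 0 < D by rewrite subr_gt0.
pose s' := s / Num.sqrt D; pose m' := 2 * t * c * s ^+ 2 / D.
have sD0 : 0 < Num.sqrt D by rewrite sqrtr_gt0.
have s'0 : s' != 0 by rewrite mulf_neq0// invr_eq0 gt_eqF.
have s'E : s' ^+ 2 = s ^+ 2 / D by rewrite exprMn exprVn sqr_sqrtr// ltW.
have s2 : 0 < s ^+ 2 by rewrite exprn_even_gt0.
rewrite (ge0_integral_normal_law PE); first last.
- by move=> x; rewrite lee_fin expR_ge0.
- apply/measurable_EFinP/measurableT_comp => //; apply: measurable_funM => //.
  by apply: measurable_funX; exact: measurable_funD.
transitivity (\int[mu]_x (((Num.sqrt D)^-1 * expR (t / D * c ^+ 2))%:E *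
    (normal_pdf m' s' x)%:E))%E.
  apply: eq_integral => x _; rewrite -!EFinM; congr EFin.
  rewrite !normal_pdfE// /normal_fun.
  have -> : normal_peak s' = Num.sqrt D * normal_peak s.
    rewrite /normal_peak s'E.
    have -> : s ^+ 2 / D * pi *+ 2 = s ^+ 2 * pi *+ 2 / D.
      by rewrite -mulrnAl; ring.
    rewrite sqrtrM ?sqrtrV ?invfM ?invrK 1?mulrC// ?ltW//.
    by rewrite mulrn_wgt0// mulr_gt0// pi_gt0.
  rewrite mulrACA mulKf ?gt_eqF// [LHS]mulrCA; congr (_ * _).
  rewrite -!expRD; congr expR.
  rewrite subr0 s'E /m' /D; field.
  by rewrite -/D gt_eqF.
rewrite ge0_integralZl_EFin//.
- by rewrite integral_normal_pdf mule1.
- by move=> x _; rewrite lee_fin normal_pdf_ge0.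
- by apply/measurable_EFinP; exact: measurable_normal_pdf.
Qed.

(** Integrating the noise [v] first leaves the exponential of a multiple [t'] of [h ^+ 2], to which
    the one-variable formula with [c = 0] applies; the two square roots multiply to the one
    claimed. *)
Lemma integral2_normal_law_expR_sqr (P Q : {measure set R -> \bar R})
    (sH sV a t : R) : P = normal_prob 0 sH :> (set R -> \bar R) ->
  Q = normal_prob 0 sV :> (set R -> \bar R) -> sH != 0 -> sV != 0 ->
  2 * t * (a ^+ 2 * sH ^+ 2 + sV ^+ 2) < 1 ->
  (\int[P]_h \int[Q]_v
     (expR (t * (h * a + v) ^+ 2))%:E =
   ((Num.sqrt (1 - 2 * t * (a ^+ 2 * sH ^+ 2 + sV ^+ 2)))^-1)%:E)%E.
Proof.
move=> PE QE sH0 sV0 ht.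
have sH2 : 0 < sH ^+ 2 by rewrite exprn_even_gt0.
have sV2 : 0 < sV ^+ 2 by rewrite exprn_even_gt0.
have a2 : 0 <= a ^+ 2 by exact: sqr_ge0.
have htV : 2 * t * sV ^+ 2 < 1.
  have [t0|t0] := leP t 0; first by nra.
  by have := mulr_ge0 (ltW t0) (mulr_ge0 a2 (ltW sH2)); nra.
set D := 1 - 2 * t * sV ^+ 2.
have D0 : 0 < D by rewrite subr_gt0.
pose t' := t * a ^+ 2 / D.
have ht' : 2 * t' * sH ^+ 2 < 1.
  rewrite /t' (_ : 2 * _ * _ = 2 * t * a ^+ 2 * sH ^+ 2 / D); last by ring.
  by rewrite ltr_pdivrMr// mul1r /D; lra.
under eq_integral => h _.
  rewrite (integral_normal_law_expR_sqr _ QE sV0 htV) -/D.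
  rewrite (_ : t / D * (h * a) ^+ 2 = t' * (0 + h) ^+ 2); last first.
    by rewrite /t'; ring.
  rewrite EFinM; over.
rewrite ge0_integralZl_EFin//.
- rewrite (integral_normal_law_expR_sqr _ PE sH0 ht') expr0n/= mulr0 expR0.
  rewrite mulr1.
  rewrite -EFinM -invfM -sqrtrM ?ltW//; congr (EFin (Num.sqrt _)^-1).
  rewrite /t' mulrBr mulr1 /D; field.
  by rewrite -/D gt_eqF.
- apply/measurable_EFinP/measurableT_comp => //; apply: measurable_funM => //.
  by apply: measurable_funX; exact: measurable_funD.
Qed.

End gaussian.

(** * A rational upper bound for the logarithm *)

Section ln_bound.
Context (R : realType).

(** The right side minus the left side of the logarithm bound at [u = 1 + x], decomposed into
    partial fractions; it vanishes at [u = 1]. *)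
Let f (u : R) : R := 4^-1 * u + 7 / 8 - ln u - 27 / 8 * (1 + 2 * u)^-1.
Let f' (u : R) : R := (u - 1) ^+ 3 / (u * (1 + 2 * u) ^+ 2).

Let is_derive_f (u : R) : 0 < u -> is_derive u 1 f (f' u).
Proof.
move=> u0.
have u1 : 1 + 2 * u != 0 by rewrite gt_eqF// addr_gt0// mulr_gt0.
have dln := is_derive1_ln u0.
rewrite /f; apply: is_derive_eq.
rewrite /f' /GRing.scale/=; field.
by rewrite u1 gt_eqF.
Qed.

Let derivable_f (u : R) : 0 < u -> derivable f u 1.
Proof. by move=> /is_derive_f[]. Qed.

Let derive_f (u : R) : 0 < u -> derive1 f u = f' u.
Proof. by move=> /is_derive_f[_ <-]; rewrite derive1E. Qed.

Let continuous_f (a b : R) : 0 < a -> {within `[a, b], continuous f}.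
Proof.
move=> a0; apply: derivable_within_continuous => u.
by rewrite in_itv/= => /andP[au _]; apply: derivable_f; exact: lt_le_trans au.
Qed.

(* Both sides have the same Taylor expansion at [0] up to order 3, and their
   difference has derivative [x ^+ 3 / ((1 + x) * (3 + 2 * x) ^+ 2)]. *)
Lemma ln1D_le (x : R) : -1 < x ->
  ln (1 + x) <= x - 3 * x ^+ 2 / (2 * (3 + 2 * x)).
Proof.
move=> x1.
(* This factorisation shows that [f'] has the sign of [u - 1], so [f] is minimal at 1. *)
have f'E (u : R) : 0 < u ->
    f' u = (u - 1) * ((u - 1) ^+ 2 / (u * (1 + 2 * u) ^+ 2)).
  by move=> u0; rewrite /f' mulrA -exprS.
have f'ge0 (u : R) : 0 < u -> 0 <= (u - 1) ^+ 2 / (u * (1 + 2 * u) ^+ 2).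
  move=> u0; apply: divr_ge0; first exact: sqr_ge0.
  by apply: mulr_ge0; [exact: ltW|exact: sqr_ge0].
suff : f 1 <= f (1 + x).
  rewrite /f ln1 => fx; rewrite -subr_ge0; move: fx; rewrite -subr_ge0.
  congr (0 <= _); field.
  by rewrite gt_eqF//; lra.
have [x0|x0] := leP 0 x.
- have mono : {in `[1, 1 + x]%R &, {homo f : y z / y <= z}}.
    apply: ger0_derive1_le_cc => [u|u|]; last exact: continuous_f.
      rewrite in_itv/= => /andP[u1 _]; apply: derivable_f.
      exact: lt_trans u1.
    rewrite in_itv/= => /andP[u1 _].
    have u0 : 0 < u by exact: lt_trans u1.
    by rewrite derive_f// f'E// mulr_ge0 ?f'ge0// subr_ge0 ltW.
  by apply: mono; rewrite ?in_itv/= ?lexx ?lerDl ?x0.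
- have mono : {in `[1 + x, 1]%R &, {homo f : y z /~ y <= z}}.
    apply: ler0_derive1_le_cc => [u|u|]; last by apply: continuous_f; lra.
      by rewrite in_itv/= => /andP[u1 _]; apply: derivable_f; lra.
    rewrite in_itv/= => /andP[u1 u2].
    have u0 : 0 < u by lra.
    by rewrite derive_f// f'E// mulr_le0_ge0 ?f'ge0// subr_le0 ltW.
  by apply: mono; rewrite ?in_itv/= ?lexx ?gerDl ?(ltW x0).
Qed.

End ln_bound.

(** * Chernoff bound for the sum of squared components *)

Section sum_of_squares_tail.
Context d (T : measurableType d) (R : realType).
Variables (P : probability T R) (I Q : finType) (Z : I -> {RV P >-> R}).
Variables (a b : Q -> I) (c : Q -> R) (sH sV v : R).
Hypothesis Zindep : mutually_independent Z.
Hypotheses (a_inj : injective a) (b_inj : injective b).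
Hypothesis ab : forall q q', a q != b q'.
Hypotheses (sH0 : sH != 0) (sV0 : sV != 0).
Hypothesis Za : forall q, distribution P (Z (a q)) = normal_prob 0 sH.
Hypothesis Zb : forall q, distribution P (Z (b q)) = normal_prob 0 sV.
Hypothesis vE : forall q, c q ^+ 2 * sH ^+ 2 + sV ^+ 2 = v.

Let U w := \sum_q (Z (a q) w * c q + Z (b q) w) ^+ 2.

Lemma measurable_sum_sqr : measurable_fun setT U.
Proof.
apply: measurable_sum => q; apply: measurable_funX.
by apply: measurable_funD => //; exact: measurable_funM.
Qed.

Lemma mgf_sum_sqr (t : R) : 2 * t * v < 1 ->
  (\int[P]_w (expR (t * U w))%:E =
   ((Num.sqrt (1 - 2 * t * v))^-1 ^+ #|Q|)%:E)%E.
Proof.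
move=> tv.
pose g q (z : R * R) := expR (t * (z.1 * c q + z.2) ^+ 2).
have mg q : measurable_fun setT (g q).
  apply: measurableT_comp => //; apply: measurable_funM => //.
  apply: measurable_funX; apply: measurable_funD; last exact: measurable_snd.
  by apply: measurable_funM => //; exact: measurable_fst.
have := integral_prod_independent_pairs Zindep a_inj b_inj ab mg
  (fun q z => expR_ge0 _) (index_enum_uniq Q).
rewrite (_ : (\prod_(q <- _) _)%E =
    (\prod_(q : Q) ((Num.sqrt (1 - 2 * t * v))^-1)%:E)%E); last first.
  apply: eq_bigr => q _.
  by rewrite /g/= (integral2_normal_law_expR_sqr (Za q) (Zb q))// vE.
rewrite prodEFin prodr_const => <-; apply: eq_integral => w _.
by rewrite /g /U mulr_sumr expR_sum.
Qed.

(* The exponential parameter [x / (2 * v * (1 + x))] is the optimal one in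
   Chernoff's bound; its sign is that of [x], so [x > 0] gives the upper tail
   and [x < 0] the lower tail. *)
Lemma chernoff_sum_sqr (x : R) : 0 < v -> -1 < x ->
  (P [set w | (x * (#|Q|%:R * v * (1 + x)) <= x * U w)%R] <=
   (expR (#|Q|%:R / 2 * (ln (1 + x) - x)))%:E)%E.
Proof.
move=> v0 x1; have x10 : 0 < 1 + x by lra.
pose t := x / (2 * v * (1 + x)).
have tvE : 1 - 2 * t * v = (1 + x)^-1.
  by rewrite /t; field; rewrite !gt_eqF.
have tv : 2 * t * v < 1 by rewrite -subr_gt0 tvE invr_gt0.
have mtU : measurable_fun setT (fun w => t * U w).
  by apply: measurable_funM => //; exact: measurable_sum_sqr.
pose X : {RV P >-> R} := mfun_Sub (mem_set mtU).
have k0 : 0 < (2 * v * (1 + x))^-1 by rewrite invr_gt0 !mulr_gt0.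
(* Scaling by the positive factor [(2 * v * (1 + x))^-1] turns [x] into [t], so one event covers
   both signs of [x]. *)
rewrite [X in P X](_ : _ = [set w | X w >= t * (#|Q|%:R * v * (1 + x))]);
  last first.
  by apply/seteqP; split => w /=; rewrite /t !(mulrAC _ _^-1) ler_pM2r.
apply: le_trans (chernoff _ _ ltr01) _.
rewrite /mmt_gen_fun unlock.
have -> : (\int[P]_w ((expR \o 1%R \o* X) w)%:E =
    \int[P]_w (expR (t * U w))%:E)%E.
  by apply: eq_integral => w _ /=; rewrite mulr1.
have sqrtE : (Num.sqrt (1 + x)^-1)^-1 = expR (2^-1 * ln (1 + x)).
  have -> : (1 + x)^-1 = expR (- (2^-1 * ln (1 + x))) ^+ 2.
    by rewrite -expRM_natl mulrN mulVKf// expRN lnK.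
  by rewrite sqrtr_sqr ger0_norm ?expR_ge0// -expRN opprK.
rewrite mgf_sum_sqr// tvE sqrtE -expRM_natl -EFinM -expRD lee_fin.
rewrite le_eqVlt; apply/orP; left; apply/eqP; congr expR.
by rewrite /t; field; rewrite !gt_eqF.
Qed.

End sum_of_squares_tail.

(** * Numerical tail estimate, union bound, and inversion for the variances *)

Lemma tail_exponent_lt (R : realType) (n eps delta x : R) :
  0 < eps < 1 -> 0 < delta < 1 -> `|x| = eps ->
  2 * (3 + 2 * eps) * ln (4 / delta) / (3 * eps ^+ 2) < n ->
  expR (n * (ln (1 + x) - x)) < delta / 4.
Proof.
move=> /andP[e0 e1] /andP[d0 d1] xe hn.
have e2 : 0 < 3 * eps ^+ 2 by rewrite mulr_gt0// exprn_gt0.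
have L0 : 0 <= ln (4 / delta) by rewrite ln_ge0// ler_pdivlMr//; lra.
have n0 : 0 < n.
  by apply: le_lt_trans hn; rewrite divr_ge0 ?(ltW e2)// mulr_ge0//; lra.
have xle : x <= eps by rewrite -xe ler_norm.
have xge : - eps <= x by rewrite -xe lerNl -normrN ler_norm.
have x2 : x ^+ 2 = eps ^+ 2 by rewrite -xe real_normK// num_real.
(* As [x <= eps], replacing [3 + 2 * x] by [3 + 2 * eps] only weakens the bound, so the upper tail
   dictates the threshold on [n] for both signs. *)
have bound : ln (1 + x) - x <= - (3 * eps ^+ 2 / (2 * (3 + 2 * eps))).
  rewrite lerBlDl; apply: le_trans (ln1D_le _) _; first by lra.
  by rewrite x2 lerD2l lerN2 ler_pM2l// lef_pV2 ?posrE; lra.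
have -> : delta / 4 = expR (- ln (4 / delta)).
  by rewrite expRN lnK ?invf_div// posrE divr_gt0.
rewrite ltr_expR; apply: le_lt_trans (ler_wpM2l (ltW n0) bound) _.
rewrite mulrN ltrN2 mulrA ltr_pdivlMr; last by lra.
by move: hn; rewrite ltr_pdivrMr// => hn; rewrite mulrC.
Qed.

Lemma measurable_between d (T : measurableType d) (R : realType)
    (f g : T -> R) (c : R) :
  measurable_fun setT f -> measurable_fun setT g ->
  measurable [set w | f w < c < g w].
Proof.
move=> mf mg.
rewrite (_ : [set w | _] = f @^-1` `]-oo, c[ `&` g @^-1` `]c, +oo[).
  by apply: measurableI; rewrite -[X in measurable X]setTI;
    [apply: mf|apply: mg].
by apply/seteqP; split => w /=; rewrite !in_itv/= andbT;
  [move=> /andP[-> ->]|move=> [-> ->]].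
Qed.

Lemma probability_gt_of_setC_cover d (T : measurableType d) (R : realType)
    (P : probability T R) (E B1 B2 B3 B4 : set T) (delta : R) :
  measurable E -> measurable B1 -> measurable B2 -> measurable B3 ->
  measurable B4 -> ~` E `<=` (B1 `|` B2) `|` (B3 `|` B4) ->
  (P B1 < (delta / 4)%:E)%E -> (P B2 < (delta / 4)%:E)%E ->
  (P B3 < (delta / 4)%:E)%E -> (P B4 < (delta / 4)%:E)%E ->
  ((1 - delta)%:E < P E)%E.
Proof.
move=> mE m1 m2 m3 m4 cover h1 h2 h3 h4.
have PC : (P (~` E) < delta%:E)%E.
  apply: (@le_lt_trans _ _ (P B1 + P B2 + (P B3 + P B4))%E).
    apply: (@le_trans _ _ (P ((B1 `|` B2) `|` (B3 `|` B4)))).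
      by apply: le_measure cover; rewrite inE;
        [exact: measurableC|do !apply: measurableU].
    apply: le_trans (measureU2 _ _ _) _; [exact: measurableU..|].
    by apply: leeD; exact: measureU2.
  rewrite (_ : delta = delta / 4 + delta / 4 + (delta / 4 + delta / 4)).
    by rewrite !EFinD !lteD.
  by field.
have mCE : measurable (~` E) by exact: measurableC.
rewrite -[E]setCK probability_setC//; move: PC.
by rewrite -(fineK (fin_num_measure P _ mCE)) -EFinB !lte_fin ltrD2l ltrN2.
Qed.

(** With means [m1 = p1 * h + v] and [m2 = p2 * h + v], one has [(p1 - p2) * h = m1 - m2] and
    [(p1 - p2) * v = p1 * m2 - p2 * m1]; each mean is then enclosed by its estimate. *)
Lemma variance_bounds (R : realType) (p1 p2 h v eps x1 x2 : R) :
  p2 < p1 -> 0 <= p2 -> 0 < eps < 1 ->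
  (1 - eps) * (p1 * h + v) < x1 < (1 + eps) * (p1 * h + v) ->
  (1 - eps) * (p2 * h + v) < x2 < (1 + eps) * (p2 * h + v) ->
  (1 / (p1 - p2) * (x1 / (1 + eps) - x2 / (1 - eps)) < h <
   1 / (p1 - p2) * (x1 / (1 - eps) - x2 / (1 + eps))) /\
  (1 / (p1 - p2) * (p1 * x2 / (1 + eps) - p2 * x1 / (1 - eps)) < v <
   1 / (p1 - p2) * (p1 * x2 / (1 - eps) - p2 * x1 / (1 + eps))).
Proof.
move=> p21 p20 /andP[e0 e1] /andP[x1l x1u] /andP[x2l x2u].
have dp : 0 < p1 - p2 by rewrite subr_gt0.
have p10 : 0 < p1 by exact: le_lt_trans p21.
have ep : 0 < 1 + eps by lra.
have em : 0 < 1 - eps by lra.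
have {}x1l : p1 * h + v < x1 / (1 - eps) by rewrite ltr_pdivlMr// mulrC.
have {}x2l : p2 * h + v < x2 / (1 - eps) by rewrite ltr_pdivlMr// mulrC.
have {}x1u : x1 / (1 + eps) < p1 * h + v by rewrite ltr_pdivrMr// mulrC.
have {}x2u : x2 / (1 + eps) < p2 * h + v by rewrite ltr_pdivrMr// mulrC.
rewrite !mul1r -!(mulrC (_ - _)) -!(mulrA p1) -!(mulrA p2).
rewrite !ltr_pdivrMr// !ltr_pdivlMr//.
(* [p2] may be zero, so these products are only weakly ordered; strictness comes from the factor
   [p1 > 0] below. *)
have y1l := ler_wpM2l p20 (ltW x1l).
have y1u := ler_wpM2l p20 (ltW x1u).
have := x2l; rewrite -(ltr_pM2l p10) => y2l.
have := x2u; rewrite -(ltr_pM2l p10) => y2u.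
by split; apply/andP; split; nra.
Qed.

(** * Application to the measurement model *)

Theorem theorem3 (d : measure_display) (T : measurableType d) (R : realType)
  (P : probability T R) (N : nat) (hN : (0 < N)%N)
  (sigmaH sigmaV : R) (hsigmaH : 0 < sigmaH ^+ 2) (hsigmaV : 0 < sigmaV ^+ 2)
  (Ps : 'I_2 -> R) (hPs : Ps l2 < Ps l1) (hPs2 : 0 <= Ps l2)
  (S : 'I_2 -> 'I_N -> R) (hS : forall l i, `|S l i| ^+ 2 = Ps l)
  (HRe HIm VRe VIm : 'I_2 -> 'I_N -> {RV P >-> R})
  (hHRe : forall l i, distribution P (HRe l i) = normal_prob 0 sigmaH)
  (hHIm : forall l i, distribution P (HIm l i) = normal_prob 0 sigmaH)
  (hVRe : forall l i, distribution P (VRe l i) = normal_prob 0 sigmaV)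
  (hVIm : forall l i, distribution P (VIm l i) = normal_prob 0 sigmaV)
  (hindep : mutually_independent
    (fun k : 'I_4 * 'I_2 * 'I_N =>
       tnth [tuple HRe; HIm; VRe; VIm] k.1.1 k.1.2 k.2))
  (eps delta : R) (heps : 0 < eps < 1) (hdelta : 0 < delta < 1)
  (hNlarge : 2 * (3 + 2 * eps) * ln (4 / delta) / (3 * eps ^+ 2) < N%:R) :
  let X := rayleigh_obs HRe HIm VRe VIm S in
  let Xbar := mean_power X in
  let dPs := Ps l1 - Ps l2 in
  let EH := [set w |
    1 / dPs * (Xbar l1 w / (1 + eps) - Xbar l2 w / (1 - eps))
    < sigmaH ^+ 2 <
    1 / dPs * (Xbar l1 w / (1 - eps) - Xbar l2 w / (1 + eps))] in
  let EV := [set w |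
    1 / dPs * (Ps l1 * Xbar l2 w / (1 + eps) - Ps l2 * Xbar l1 w / (1 - eps))
    < sigmaV ^+ 2 <
    1 / dPs * (Ps l1 * Xbar l2 w / (1 - eps) - Ps l2 * Xbar l1 w / (1 + eps))]
  in
  ((1 - delta)%:E < P (EH `&` EV))%E.
Proof.
pose Z (k : 'I_4 * 'I_2 * 'I_N) : {RV P >-> R} :=
  tnth [tuple HRe; HIm; VRe; VIm] k.1.1 k.1.2 k.2.
(* [a] indexes the fading and [b] the noise; [q.1] is [false] for the real part
   and [true] for the imaginary part. *)
pose a l (q : bool * 'I_N) : 'I_4 * 'I_2 * 'I_N := (inord q.1, l, q.2).
pose b l (q : bool * 'I_N) : 'I_4 * 'I_2 * 'I_N := (inord (2 + q.1), l, q.2).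
have a_inj l : injective (a l).
  move=> [c i] [c' i'] [/(congr1 val)/= + ->].
  by rewrite !inordK; case: c c' => -[].
have b_inj l : injective (b l).
  move=> [c i] [c' i'] [/(congr1 val)/= + ->].
  by rewrite !inordK; case: c c' => -[].
have ab l q q' : a l q != b l q'.
  apply/eqP => -[/(congr1 val)/= + _].
  by rewrite !inordK; case: (q.1) (q'.1) => -[].
have Za l q : distribution P (Z (a l q)) = normal_prob 0 sigmaH.
  rewrite /Z (tnth_nth HRe)/= inordK; last by case: q.1.
  by case: q.1; [exact: hHIm|exact: hHRe].
have Zb l q : distribution P (Z (b l q)) = normal_prob 0 sigmaV.
  rewrite /Z (tnth_nth HRe)/= inordK; last by case: q.1.
  by case: q.1; [exact: hVIm|exact: hVRe].
pose X := rayleigh_obs HRe HIm VRe VIm S.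
pose Xbar := mean_power X.
pose dPs := Ps l1 - Ps l2.
pose EH := [set w |
  1 / dPs * (Xbar l1 w / (1 + eps) - Xbar l2 w / (1 - eps))
  < sigmaH ^+ 2 <
  1 / dPs * (Xbar l1 w / (1 - eps) - Xbar l2 w / (1 + eps))].
pose EV := [set w |
  1 / dPs * (Ps l1 * Xbar l2 w / (1 + eps) - Ps l2 * Xbar l1 w / (1 - eps))
  < sigmaV ^+ 2 <
  1 / dPs * (Ps l1 * Xbar l2 w / (1 - eps) - Ps l2 * Xbar l1 w / (1 + eps))].
rewrite -[is_true _]/(is_true ((1 - delta)%:E < P (EH `&` EV))%E).
pose U l w := \sum_(q : bool * 'I_N)
  (Z (a l q) w * S l q.2 + Z (b l q) w) ^+ 2.
have XbarE l w : Xbar l w = (2 * N%:R)^-1 * U l w.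
  rewrite /Xbar /mean_power /U; congr (_ * _).
  (* Regrouping by observation leaves two squares for each [i], the real and imaginary parts; these
     do not mix because the symbol is real. *)
  rewrite -(pair_big xpredT xpredT (fun c i =>
    (Z (a l (c, i)) w * S l i + Z (b l (c, i)) w) ^+ 2))/= exchange_big/=.
  apply: eq_bigr => i _; rewrite big_bool/=.
  rewrite /Z !(tnth_nth HRe)/= !inordK//=.
  rewrite sqr_sqrtr ?addr_ge0 ?sqr_ge0// !mulr0 subr0 add0r.
  by rewrite addrC.
pose v l := Ps l * sigmaH ^+ 2 + sigmaV ^+ 2.
have Ps0 l : 0 <= Ps l.
  have := hS l (Ordinal hN); rewrite real_normK ?num_real// => <-.
  exact: sqr_ge0.
have v0 l : 0 < v l by rewrite ltr_wpDl// mulr_ge0// ltW.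
have vE l (q : bool * 'I_N) : S l q.2 ^+ 2 * sigmaH ^+ 2 + sigmaV ^+ 2 = v l.
  by rewrite /v -(hS l q.2) real_normK ?num_real.
have sigmaH0 : sigmaH != 0 by rewrite -sqrf_eq0 gt_eqF.
have sigmaV0 : sigmaV != 0 by rewrite -sqrf_eq0 gt_eqF.
have [/andP[e0 e1] n0] : 0 < eps < 1 /\ 0 < N%:R :> R by rewrite ltr0n.
have mU l : measurable_fun setT (U l) by exact: measurable_sum_sqr.
have mXbar l : measurable_fun setT (Xbar l).
  by rewrite (_ : Xbar l = fun w => (2 * N%:R)^-1 * U l w);
    [exact: measurable_funM|apply/funext => w; exact: XbarE].
(* For [x = eps] this is the event of too large a mean power; for [x = - eps] the factor [x]
   reverses the inequality and gives too small a one. *)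
pose B l x := [set w | x * (v l * (1 + x)) <= x * Xbar l w].
have mB l x : measurable (B l x).
  rewrite (_ : B l x =
      (fun w => x * Xbar l w) @^-1` `[x * (v l * (1 + x)), +oo[).
    by rewrite -[X in measurable X]setTI; apply: measurable_funM.
  by apply/seteqP; split => w /=; rewrite in_itv/= andbT.
have PB l (x : R) : `|x| = eps -> (P (B l x) < (delta / 4)%:E)%E.
  move=> xe; have x1 : -1 < x.
    by have := ler_norm (- x); rewrite normrN xe; lra.
  have n2 : 2 * N%:R != 0 :> R by rewrite mulf_neq0// gt_eqF.
  (* The two real components of each observation give [2 * N] terms, so the Chernoff exponent, which
     has half the cardinal, carries the factor [N]. *)
  have cardQ : #|{: bool * 'I_N}|%:R = 2 * N%:R :> R.
    by rewrite card_prod card_bool card_ord natrM.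
  have -> : B l x =
      [set w | x * (#|{: bool * 'I_N}|%:R * v l * (1 + x)) <= x * U l w].
    apply: eq_set => w; congr is_true.
    rewrite XbarE cardQ -[in RHS](mulVKf n2 (U l w)).
    by rewrite -mulrA !(mulrCA x (2 * N%:R)) [RHS]ler_pM2l ?mulr_gt0.
  have := chernoff_sum_sqr hindep (a_inj l) (b_inj l) (ab l) sigmaH0 sigmaV0
    (Za l) (Zb l) (vE l) (v0 l) x1.
  move=> /le_lt_trans; apply; rewrite lte_fin cardQ (mulrC 2) mulfK//.
  exact: tail_exponent_lt xe hNlarge.
apply: (probability_gt_of_setC_cover (B1 := B l1 eps) (B2 := B l1 (- eps))
  (B3 := B l2 eps) (B4 := B l2 (- eps)));
  rewrite ?mB ?PB ?normrN ?gtr0_norm//.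
- apply: measurableI; apply: measurable_between;
  by apply: measurable_funM => //; apply: measurable_funB;
    do ?[apply: measurable_funM => //].
have notB l w : ~ B l eps w -> ~ B l (- eps) w ->
    (1 - eps) * v l < Xbar l w < (1 + eps) * v l.
  rewrite /B/= => /negP + /negP; rewrite -!ltNge !mulNr ltrN2 !ltr_pM2l//.
  by move=> u1 u2; rewrite mulrC u2 mulrC u1.
move=> w; apply: contra_notP => /not_orP[/not_orP[n1 n2] /not_orP[n3 n4]].
have [] := variance_bounds hPs hPs2 heps (notB _ _ n1 n2) (notB _ _ n3 n4).
by split.
Qed.
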